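(* Let $\mathcal{M}$ be an $S4^\forall_\equiv$-model and $\gamma\colon V\rightarrow M$ an assignment. There exist a frame $(W,R)$ of modal logic $S4$, a valuation $g\colon V\rightarrow Pow(W)$ and a world $w\in W$ such that for all $\varphi,\psi\in Fm_m$: $(\mathcal{M},\gamma)\vDash\varphi\Leftrightarrow(w,g)\vDash\varphi$, and $(\mathcal{M},\gamma)\vDash\varphi\equiv\psi\Rightarrow(w,g)\vDash\square(\varphi\leftrightarrow\psi)$. Moreover, if $\mathcal{M}$ satisfies the Collapse Axiom and is a Boolean algebra, the latter implication is a biconditional.
   Context: Language: $Fm(C)$ is the set of formulas built from propositional variables $V$, a set $C$ of constants containing $\top,\bot$, connectives $\neg,\rightarrow,\vee,\wedge$, identity connective $\equiv$, necessity $\square$ and universal propositional quantifier $\forall$. $Fm_m\subseteq Fm(C)$ is the set of formulas of basic modal logic: quantifier-free, without $\equiv$, and with no constants other than $\bot,\top$. $\varphi\leftrightarrow\psi$ abbreviates $(\varphi\rightarrow\psi)\wedge(\psi\rightarrow\varphi)$. The Collapse Axiom is $(\square\varphi\wedge\square\psi)\rightarrow(\varphi\equiv\psi)$. Frames of $S4$ are Kripke frames $(W,R)$ with $R$ reflexive and transitive, with the usual Kripke satisfaction $(w,g)\vDash\varphi$. Models: a propositional domain is $\mathcal{M}=(M,\mathit{TRUE},\mathit{NEC},f_\bot,f_\top,f_\square,f_\neg,f_\vee,f_\wedge,f_\rightarrow,f_\equiv,f_\forall,\varGamma)$ with $\mathit{TRUE},\mathit{NEC}\subseteq M$, operations of obvious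 arities, $f_\forall\colon M^M\to M$, $\varGamma\colon C\to M$ with $\varGamma(\bot)=f_\bot,\varGamma(\top)=f_\top$; assignments $\gamma\colon V\to M$ extend homomorphically with $\gamma(c)=\varGamma(c)$ and $\gamma(\forall x\varphi)=f_\forall(m\mapsto\gamma_x^m(\varphi))$. $t\colon M\to M$ is $(\varphi,x,\gamma)$-definable if $t(m)=\gamma_x^m(\varphi)$ for all $m$ (definable if so for some $\varphi,x,\gamma$). With $a\le_\mathcal{M}b:\Leftrightarrow f_\rightarrow(a,b)\in\mathit{NEC}$ and $\approx_\mathcal{M}$ its symmetric part, $\mathcal{M}$ is an $S3^\forall_\equiv$-model if: (1) when $\mathit{NEC}\neq\varnothing$, $\le_\mathcal{M}$ is a preorder making $(M,f_\bot,f_\top,f_\neg,f_\vee,f_\wedge,f_\rightarrow,\le_\mathcal{M})$ a Boolean prealgebra ($\approx_\mathcal{M}$ a congruence with Boolean-algebra quotient ordered by $\le_\mathcal{M}$); (2) $f_\bot\notin\mathit{TRUE}$, $f_\top\in\mathit{TRUE}$, classical truth conditions for $f_\rightarrow,f_\neg,f_\wedge,f_\vee$, $f_\square(a)\in\mathit{TRUE}\Leftrightarrow a\in\mathit{NEC}$, $f_\equiv(a,b)\in\mathit{TRUE}\Leftrightarrow a=b$, $f_\forall(t)\in\mathit{TRUE}$ for definable $t$ with image in $\mathit{TRUE}$; (3) when $\mathit{NEC}\neq\varnothing$, $\mathit{NEC}\subseteq\mathit{TRUE}$ is upward closed under $\le_\mathcal{M}$ and closed under $f_\wedge$; (4) when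 $\mathit{NEC}\neq\varnothing$: $f_\top\le_\mathcal{M}f_\equiv(a,a)$; $f_\equiv(a,b)\le_\mathcal{M}f_\rightarrow(a,b)$; $f_\equiv(a,b)\le_\mathcal{M}f_\equiv(t(a),t(b))$ for definable $t$; $f_\square(a)\le_\mathcal{M}a$; $f_\square(f_\rightarrow(a,b))\le_\mathcal{M}f_\rightarrow(f_\square(a),f_\square(b))$; $f_\square(f_\rightarrow(a,b))\le_\mathcal{M}f_\square(f_\rightarrow(f_\square(a),f_\square(b)))$; $f_\forall(t)\le_\mathcal{M}f_\equiv(f_\forall(t_1),f_\forall(t_2))$ and $f_\forall(t)\le_\mathcal{M}f_\rightarrow(f_\forall(t_1),f_\forall(t_2))$ for $t_1,t_2$ $(\varphi,x,\gamma)$-, $(\psi,x,\gamma)$-definable and $t$ the pointwise $f_\equiv$, resp. $f_\rightarrow$, of $t_1,t_2$; $f_\forall(t)\le_\mathcal{M}t(a)$ for definable $t$; $f_\forall(t)\le_\mathcal{M}f_\rightarrow(b,f_\forall(t'))$ for $t'$ $(\psi,x,\gamma)$-definable, $b$ the denotation of a sentence and $t(a)=f_\rightarrow(b,t'(a))$; $f_\square(f_\forall(t))\approx_\mathcal{M}f_\forall(a\mapsto f_\square(t(a)))$ for definable $t$; $f_\forall(t)\in\mathit{NEC}$ for definable $t$ with image in $\mathit{NEC}$. It is normal if $\mathit{NEC}\neq\varnothing$. A normal $S3^\forall_\equiv$-model is an $S4^\forall_\equiv$-model if $f_\square(a)\le_\mathcal{M}f_\square(f_\square(a))$ for all $a$.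 $(\mathcal{M},\gamma)\vDash\varphi:\Leftrightarrow\gamma(\varphi)\in\mathit{TRUE}$. ''$\mathcal{M}$ is a Boolean algebra'' refers to $(M,f_\bot,f_\top,f_\neg,f_\vee,f_\wedge,f_\rightarrow)$. *)

(* Defs.v *)
From mathcomp Require Import all_boot.
From mathcomp Require Import boolp classical_sets.

Set Implicit Arguments.
Unset Strict Implicit.
Unset Printing Implicit Defensive.

Local Open Scope classical_set_scope.

Record constants := Constants {
  csort :> Type;
  cbot : csort;
  ctop : csort;
  cbot_neq_ctop : cbot <> ctop }.

(** [Fm(C)]: [Id] is the identity connective, [All x A] is the propositional
    quantifier. *)
Inductive form (V : eqType) (C : constants) : Type :=
  | Var of V
  | Const of C
  | Neg of form V C
  | Imp of form V C & form V C
  | Or of form V C & form V C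
  | And of form V C & form V C
  | Id of form V C & form V C
  | Box of form V C
  | All of V & form V C.

Arguments Var {V C} _.
Arguments Const {V C} _.

Fixpoint free (V : eqType) (C : constants) (x : V) (A : form V C) : bool :=
  match A with
  | Var y => y == x
  | Const _ => false
  | Neg B | Box B => free x B
  | Imp B B' | Or B B' | And B B' | Id B B' => free x B || free x B'
  | All y B => (y != x) && free x B
  end.

Definition sentence (V : eqType) (C : constants) (A : form V C) : Prop :=
  forall x, ~~ free x A.

(** [Fm_m], a fragment of [Fm(C)] through the injection [emb] below. *)
Inductive mform (V : eqType) : Type :=
  | MVar of V
  | MBot
  | MTop
  | MNeg of mform V
  | MImp of mform V & mform V
  | MOr of mform V & mform V
  | MAnd of mform V & mform V
  | MBox of mform V.

Arguments MBot {V}.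
Arguments MTop {V}.

Definition MIff (V : eqType) (A B : mform V) : mform V :=
  MAnd (MImp A B) (MImp B A).

Fixpoint emb (V : eqType) (C : constants) (A : mform V) : form V C :=
  match A with
  | MVar x => Var x
  | MBot => Const (cbot C)
  | MTop => Const (ctop C)
  | MNeg B => Neg (emb C B)
  | MImp B B' => Imp (emb C B) (emb C B')
  | MOr B B' => Or (emb C B) (emb C B')
  | MAnd B B' => And (emb C B) (emb C B')
  | MBox B => Box (emb C B)
  end.

Record S4_frame := S4Frame {
  world :> Type;
  acc : world -> world -> Prop;
  acc_refl : forall w, acc w w;
  acc_trans : forall u v w, acc u v -> acc v w -> acc u w }.

Fixpoint forces (V : eqType) (F : S4_frame) (g : V -> set F) (w : F)
    (A : mform V) : Prop :=
  match A with
  | MVar x => g x w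
  | MBot => False
  | MTop => True
  | MNeg B => ~ forces g w B
  | MImp B B' => forces g w B -> forces g w B'
  | MOr B B' => forces g w B \/ forces g w B'
  | MAnd B B' => forces g w B /\ forces g w B'
  | MBox B => forall v, acc w v -> forces g v B
  end.

Record domain (C : constants) := Domain {
  carrier :> Type;
  TRUE : set carrier;
  NEC : set carrier;
  f_bot : carrier;
  f_top : carrier;
  f_box : carrier -> carrier;
  f_neg : carrier -> carrier;
  f_or : carrier -> carrier -> carrier;
  f_and : carrier -> carrier -> carrier;
  f_imp : carrier -> carrier -> carrier;
  f_id : carrier -> carrier -> carrier;
  f_all : (carrier -> carrier) -> carrier;
  Gamma : C -> carrier;
  Gamma_bot : Gamma (cbot C) = f_bot;
  Gamma_top : Gamma (ctop C) = f_top }.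

Arguments f_bot {C} _.
Arguments f_top {C} _.

Definition upd (V : eqType) (T : Type) (gam : V -> T) (x : V) (m : T) : V -> T :=
  fun y => if y == x then m else gam y.

Fixpoint eval (V : eqType) (C : constants) (M : domain C) (gam : V -> M)
    (A : form V C) : M :=
  match A with
  | Var x => gam x
  | Const c => Gamma M c
  | Neg B => f_neg (eval gam B)
  | Imp B B' => f_imp (eval gam B) (eval gam B')
  | Or B B' => f_or (eval gam B) (eval gam B')
  | And B B' => f_and (eval gam B) (eval gam B')
  | Id B B' => f_id (eval gam B) (eval gam B')
  | Box B => f_box (eval gam B)
  | All x B => f_all (fun m => eval (upd gam x m) B)
  end.

Definition holds (V : eqType) (C : constants) (M : domain C) (gam : V -> M)
    (A : form V C) : Prop :=
  TRUE (eval gam A).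

Definition definable_by (V : eqType) (C : constants) (M : domain C)
    (A : form V C) (x : V) (gam : V -> M) (t : M -> M) : Prop :=
  forall m, t m = eval (upd gam x m) A.

Definition definable (V : eqType) (C : constants) (M : domain C)
    (t : M -> M) : Prop :=
  exists (A : form V C) (x : V) (gam : V -> M), definable_by A x gam t.

Definition leM (C : constants) (M : domain C) (a b : M) : Prop :=
  NEC (f_imp a b).

Definition eqvM (C : constants) (M : domain C) (a b : M) : Prop :=
  leM a b /\ leM b a.

(** The laws of Boolean algebras for the operations of [M], read modulo [E]:
    for [E := eq] they say that [M] is a Boolean algebra, for a congruence [E]
    that the quotient of [M] by [E] is one. *)
Record boolean_laws (C : constants) (M : domain C) (E : M -> M -> Prop) : Prop := {
  ba_or_comm : forall a b, E (f_or a b) (f_or b a);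
  ba_and_comm : forall a b, E (f_and a b) (f_and b a);
  ba_or_assoc : forall a b c, E (f_or a (f_or b c)) (f_or (f_or a b) c);
  ba_and_assoc : forall a b c, E (f_and a (f_and b c)) (f_and (f_and a b) c);
  ba_or_absorb : forall a b, E (f_or a (f_and a b)) a;
  ba_and_absorb : forall a b, E (f_and a (f_or a b)) a;
  ba_or_distr : forall a b c, E (f_or a (f_and b c)) (f_and (f_or a b) (f_or a c));
  ba_and_distr : forall a b c, E (f_and a (f_or b c)) (f_or (f_and a b) (f_and a c));
  ba_or_bot : forall a, E (f_or a (f_bot M)) a;
  ba_and_top : forall a, E (f_and a (f_top M)) a;
  ba_or_neg : forall a, E (f_or a (f_neg a)) (f_top M);
  ba_and_neg : forall a, E (f_and a (f_neg a)) (f_bot M);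
  ba_imp_def : forall a b, E (f_imp a b) (f_or (f_neg a) b) }.

Definition boolean_algebra (C : constants) (M : domain C) : Prop :=
  boolean_laws (@eq M).

Record boolean_prealgebra (C : constants) (M : domain C) : Prop := {
  bp_le_refl : forall a : M, leM a a;
  bp_le_trans : forall a b c : M, leM a b -> leM b c -> leM a c;
  bp_cong_neg : forall a a' : M, eqvM a a' -> eqvM (f_neg a) (f_neg a');
  bp_cong_or : forall a a' b b' : M, eqvM a a' -> eqvM b b' ->
    eqvM (f_or a b) (f_or a' b');
  bp_cong_and : forall a a' b b' : M, eqvM a a' -> eqvM b b' ->
    eqvM (f_and a b) (f_and a' b');
  bp_cong_imp : forall a a' b b' : M, eqvM a a' -> eqvM b b' ->
    eqvM (f_imp a b) (f_imp a' b');
  bp_quotient_laws : boolean_laws (@eqvM C M);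
  (* the lattice order of the quotient is the one induced by [leM] *)
  bp_quotient_order : forall a b : M, leM a b <-> eqvM (f_and a b) a }.

Record truth_conditions (V : eqType) (C : constants) (M : domain C) : Prop := {
  true_bot : ~ TRUE (f_bot M);
  true_top : TRUE (f_top M);
  true_imp : forall a b : M, TRUE (f_imp a b) <-> (TRUE a -> TRUE b);
  true_neg : forall a : M, TRUE (f_neg a) <-> ~ TRUE a;
  true_and : forall a b : M, TRUE (f_and a b) <-> TRUE a /\ TRUE b;
  true_or : forall a b : M, TRUE (f_or a b) <-> TRUE a \/ TRUE b;
  true_box : forall a : M, TRUE (f_box a) <-> NEC a;
  true_id : forall a b : M, TRUE (f_id a b) <-> a = b;
  true_all : forall t : M -> M, definable V t ->
    (forall m, TRUE (t m)) -> TRUE (f_all t) }.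

Record nec_filter (C : constants) (M : domain C) : Prop := {
  nec_true : @NEC C M `<=` @TRUE C M;
  nec_up : forall a b : M, NEC a -> leM a b -> NEC b;
  nec_and : forall a b : M, NEC a -> NEC b -> NEC (f_and a b) }.

Record S3_inequalities (V : eqType) (C : constants) (M : domain C) : Prop := {
  id_refl : forall a : M, leM (f_top M) (f_id a a);
  id_imp : forall a b : M, leM (f_id a b) (f_imp a b);
  id_subst : forall (t : M -> M) (a b : M), definable V t ->
    leM (f_id a b) (f_id (t a) (t b));
  box_T : forall a : M, leM (f_box a) a;
  box_K : forall a b : M, leM (f_box (f_imp a b)) (f_imp (f_box a) (f_box b));
  box_S3 : forall a b : M,
    leM (f_box (f_imp a b)) (f_box (f_imp (f_box a) (f_box b)));
  all_id : forall (A B : form V C) (x : V) (gam : V -> M) (t1 t2 : M -> M),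
    definable_by A x gam t1 -> definable_by B x gam t2 ->
    leM (f_all (fun m => f_id (t1 m) (t2 m))) (f_id (f_all t1) (f_all t2));
  all_imp : forall (A B : form V C) (x : V) (gam : V -> M) (t1 t2 : M -> M),
    definable_by A x gam t1 -> definable_by B x gam t2 ->
    leM (f_all (fun m => f_imp (t1 m) (t2 m))) (f_imp (f_all t1) (f_all t2));
  all_inst : forall (t : M -> M) (a : M), definable V t -> leM (f_all t) (t a);
  all_vacuous : forall (A B : form V C) (x : V) (gam : V -> M) (t' : M -> M),
    sentence A -> definable_by B x gam t' ->
    leM (f_all (fun m => f_imp (eval gam A) (t' m)))
        (f_imp (eval gam A) (f_all t'));
  box_all : forall t : M -> M, definable V t ->
    eqvM (f_box (f_all t)) (f_all (fun m => f_box (t m)));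
  nec_all : forall t : M -> M, definable V t ->
    (forall m, NEC (t m)) -> NEC (f_all t) }.

Record S3_model (V : eqType) (C : constants) (M : domain C) : Prop := {
  S3_prealgebra : @NEC C M !=set0 -> boolean_prealgebra M;
  S3_truth : truth_conditions V M;
  S3_filter : @NEC C M !=set0 -> nec_filter M;
  S3_ineq : @NEC C M !=set0 -> S3_inequalities V M }.

Definition normal (C : constants) (M : domain C) : Prop := @NEC C M !=set0.

Record S4_model (V : eqType) (C : constants) (M : domain C) : Prop := {
  S4_S3 : S3_model V M;
  S4_normal : normal M;
  S4_box : forall a : M, leM (f_box a) (f_box (f_box a)) }.

Definition collapse (V : eqType) (C : constants) (M : domain C) : Prop :=
  forall (gam : V -> M) (A B : form V C),
    holds gam (Imp (And (Box A) (Box B)) (Id A B)).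

(* Main.v *)
Require Import Defs.
From mathcomp Require Import all_boot.
From mathcomp Require Import boolp classical_sets.

(** The frame is the canonical frame of the Boolean prealgebra [M]: its worlds
    are the prime filters for [leM], with [U] seeing [U'] when [f_box a] in [U]
    implies [a] in [U'], and the actual world is the set of true propositions.
    In each world [U] a modal formula is forced iff its denotation lies in [U];
    for [f_box a] this separates [a] from the filter of all [b] with [f_box b]
    in [U] by a prime filter. Under Collapse every necessary element is [f_top],
    and in a Boolean algebra [a -> b = b -> a = 1] forces [a = b]. *)

Set Implicit Arguments.
Unset Strict Implicit.
Unset Printing Implicit Defensive.

Local Open Scope classical_set_scope.

(** * Order in a Boolean prealgebra *)

Section Prealgebra.
Context (C : constants) (M : domain C) (HB : boolean_prealgebra M).
Implicit Types a b c x : M.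

Let laws := bp_quotient_laws HB.

Lemma eqvM_refl a : eqvM a a.
Proof. by split; apply: bp_le_refl. Qed.

Lemma eqvM_trans a b c : eqvM a b -> eqvM b c -> eqvM a c.
Proof.
by case=> ab ba [bc cb]; split; [apply: bp_le_trans ab bc|apply: bp_le_trans cb ba].
Qed.

Lemma leM_and_l a b : leM (f_and a b) a.
Proof.
apply/(bp_quotient_order HB).
apply: eqvM_trans (ba_and_comm laws _ _) _.
apply: eqvM_trans (ba_and_assoc laws _ _ _) _.
apply: bp_cong_and => //; last exact: eqvM_refl.
(* Idempotence of the meet is reflexivity of [leM] read through the quotient order. *)
by apply/(bp_quotient_order HB); apply: bp_le_refl.
Qed.

Lemma leM_and_r a b : leM (f_and a b) b.
Proof. by apply: bp_le_trans (leM_and_l b a) => //; case: (ba_and_comm laws a b). Qed.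

Lemma leM_and x a b : leM x a -> leM x b -> leM x (f_and a b).
Proof.
move=> /(bp_quotient_order HB) xa /(bp_quotient_order HB) xb.
apply/(bp_quotient_order HB).
apply: eqvM_trans (ba_and_assoc laws _ _ _) _.
by apply: eqvM_trans xb; apply: bp_cong_and => //; exact: eqvM_refl.
Qed.

Lemma leM_or_l a b : leM a (f_or a b).
Proof. by apply/(bp_quotient_order HB); apply: (ba_and_absorb laws). Qed.

Lemma leM_or_r a b : leM b (f_or a b).
Proof. by apply: bp_le_trans (leM_or_l b a) _ => //; case: (ba_or_comm laws b a). Qed.

Lemma leM_or a b c : leM a c -> leM b c -> leM (f_or a b) c.
Proof.
move=> /(bp_quotient_order HB) ac /(bp_quotient_order HB) bc.
apply/(bp_quotient_order HB).
apply: eqvM_trans (ba_and_comm laws _ _) _.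
apply: eqvM_trans (ba_and_distr laws _ _ _) _.
by apply: bp_cong_or => //; apply: eqvM_trans (ba_and_comm laws _ _) _.
Qed.

Lemma leM_and_or x a b c :
  leM (f_and x a) c -> leM (f_and x b) c -> leM (f_and x (f_or a b)) c.
Proof.
move=> xa xb; apply: bp_le_trans (leM_or xa xb) => //.
by case: (ba_and_distr laws x a b).
Qed.

Lemma leM_top a : leM a (f_top M).
Proof. by apply/(bp_quotient_order HB); apply: (ba_and_top laws). Qed.

Lemma leM_bot a : leM (f_bot M) a.
Proof. by apply: bp_le_trans (leM_or_r a _) _ => //; case: (ba_or_bot laws a). Qed.

Lemma leM_imp a b : leM b (f_imp a b).
Proof.
by apply: bp_le_trans (leM_or_r (f_neg a) b) _ => //; case: (ba_imp_def laws a b).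
Qed.

(** Distributing [f_neg a] over the meet leaves the factor [f_or (f_neg a) a], which is equivalent
    to top. This curried form of meet introduction is what axiom K can be applied to. *)
Lemma leM_imp_and a b : leM b (f_imp a (f_and a b)).
Proof.
apply: (@bp_le_trans _ _ HB _ (f_or (f_neg a) (f_and a b))); last first.
  by case: (ba_imp_def laws a (f_and a b)).
apply: (@bp_le_trans _ _ HB _ (f_and (f_or (f_neg a) a) (f_or (f_neg a) b))).
  apply: leM_and; last exact: leM_or_r.
  apply: (bp_le_trans HB (leM_top b)).
  apply: (@bp_le_trans _ _ HB _ (f_or a (f_neg a))).
    by case: (ba_or_neg laws a).
  by case: (ba_or_comm laws a (f_neg a)).
by case: (ba_or_distr laws (f_neg a) a b).
Qed.

End Prealgebra.

(** * Prime filters *)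

Section PrimeFilters.
Context (C : constants) (M : domain C).

Record filterM (U : set M) : Prop := FilterM {
  filterM_up : forall a b, U a -> leM a b -> U b;
  filterM_and : forall a b, U a -> U b -> U (f_and a b);
  filterM_top : U (f_top M) }.

Record prime_filterM (U : set M) : Prop := PrimeFilterM {
  prime_filterM_filter :> filterM U;
  prime_filterM_bot : ~ U (f_bot M);
  prime_filterM_or : forall a b, U (f_or a b) -> U a \/ U b }.

Context (HB : boolean_prealgebra M).

(** This is the filter generated by [U] and [b]; two witnesses from [U] are merged by taking their
    meet. *)
Lemma filterM_adjoin (U : set M) (b : M) : filterM U ->
  filterM [set c | exists2 x, U x & leM (f_and x b) c].
Proof.
move=> fU; split=> [c d [x Ux xc] cd|c d [x Ux xc] [y Uy yd]|].
- by exists x => //; apply: bp_le_trans xc cd.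
- exists (f_and x y); first exact: filterM_and.
  have xyb z : leM (f_and x y) z -> leM (f_and (f_and x y) b) (f_and z b).
    move=> xyz; apply: leM_and => //; last exact: leM_and_r.
    by apply: bp_le_trans xyz => //; apply: leM_and_l.
  apply: leM_and => //.
    by apply: bp_le_trans (xyb x _) xc => //; apply: leM_and_l.
  by apply: bp_le_trans (xyb y _) yd => //; apply: leM_and_r.
- by exists (f_top M); [exact: filterM_top|exact: leM_top].
Qed.

(** By Zorn's lemma some filter is maximal among those that include [F] and omit [a]; maximality and
    distributivity make it prime. *)
Lemma prime_filterM_separation (F : set M) (a : M) : filterM F -> ~ F a ->
  exists U, [/\ prime_filterM U, F `<=` U & ~ U a].
Proof.
move=> fF Fa.
(* The empty set is admitted because it is the union of the empty chain. *)
pose P (U : set M) := U = set0 \/ [/\ filterM U, F `<=` U & ~ U a].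
have [|U [PU maxU]] := @Zorn_bigcup M P.
  move=> G GP totG.
  have [[X GX [x Xx]]|G0] := pselect (exists2 X, G X & X !=set0); last first.
    left; rewrite -subset0 => x [X GX Xx].
    by case: G0; exists X => //; exists x.
  have GPn Y : G Y -> Y !=set0 -> [/\ filterM Y, F `<=` Y & ~ Y a].
    by move=> /GP[-> [y []]|[]].
  have [fX FX _] := GPn X GX (ex_intro _ x Xx).
  right; split.
  - split.
    + move=> b c [Y GY Yb] bc; exists Y => //.
      by have [fY _ _] := GPn Y GY (ex_intro _ b Yb); apply: filterM_up Yb bc.
    + move=> b c [Y GY Yb] [Z GZ Zc].
      have [fY _ _] := GPn Y GY (ex_intro _ b Yb).
      have [fZ _ _] := GPn Z GZ (ex_intro _ c Zc).
      case: (totG Y Z GY GZ) => sub; [exists Z|exists Y] => //;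
        by apply: filterM_and => //; apply: sub.
    + by exists X => //; apply: filterM_top.
  - by move=> b Fb; exists X => //; apply: FX.
  - by move=> [Y GY Ya]; have [] := GPn Y GY (ex_intro _ a Ya).
case: PU => [U0|[fU FU Ua]].
  (* The empty set is not maximal, since [F] contains top and is itself a candidate. *)
  exfalso; apply: (maxU F); last by right; split.
  rewrite U0; split=> [|F0]; first exact: sub0set.
  exact: (F0 _ (filterM_top fF)).
exists U; split=> //; split=> //.
  by move=> Ubot; apply: Ua; apply: (filterM_up fU Ubot); apply: leM_bot.
move=> b c Ubc; apply: contrapT => /not_orP[Ub Uc].
(* Otherwise the filter generated by [U] and [d] would still omit [a] and properly extend [U]. *)
have adjoin d : ~ U d -> exists2 x, U x & leM (f_and x d) a.
  move=> Ud; apply: contrapT => nex.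
  apply: (maxU [set e | exists2 x, U x & leM (f_and x d) e]).
    split=> [e Ue|sub]; first by exists e => //; apply: leM_and_l.
    apply: Ud; apply: sub; exists (f_top M); first exact: filterM_top.
    exact: leM_and_r.
  right; split=> //; first exact: filterM_adjoin.
  by move=> e /FU Ue; exists e => //; apply: leM_and_l.
have [x Ux xa] := adjoin b Ub; have [y Uy ya] := adjoin c Uc.
(* This meet lies in [U], and by distributivity it is below [a], as each of its two cases is. *)
apply: Ua; apply: (@filterM_up _ fU (f_and (f_and x y) (f_or b c))).
  by do 2?apply: filterM_and.
apply: leM_and_or => //.
- apply: bp_le_trans xa => //; apply: leM_and => //; last exact: leM_and_r.
  by apply: bp_le_trans (leM_and_l HB _ _) (leM_and_l HB _ _).
- apply: bp_le_trans ya => //; apply: leM_and => //; last exact: leM_and_r.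
  by apply: bp_le_trans (leM_and_l HB _ _) (leM_and_r HB _ _).
Qed.

Lemma prime_filterM_negE (U : set M) (a : M) : prime_filterM U ->
  U (f_neg a) <-> ~ U a.
Proof.
move=> pU; have laws := bp_quotient_laws HB; split=> [Una Ua|Ua].
  apply: (prime_filterM_bot pU).
  apply: (filterM_up pU (filterM_and pU Ua Una)).
  by case: (ba_and_neg laws a).
have : U (f_or a (f_neg a)).
  by apply: (filterM_up pU (filterM_top pU)); case: (ba_or_neg laws a).
by case/(prime_filterM_or pU).
Qed.

Lemma prime_filterM_andE (U : set M) (a b : M) : prime_filterM U ->
  U (f_and a b) <-> U a /\ U b.
Proof.
move=> pU; split=> [Uab|[Ua Ub]]; last exact: (filterM_and pU).
by split; apply: (filterM_up pU Uab); [exact: leM_and_l|exact: leM_and_r].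
Qed.

Lemma prime_filterM_orE (U : set M) (a b : M) : prime_filterM U ->
  U (f_or a b) <-> U a \/ U b.
Proof.
move=> pU; split=> [|[Ua|Ub]]; first exact: (prime_filterM_or pU).
  by apply: (filterM_up pU Ua); apply: leM_or_l.
by apply: (filterM_up pU Ub); apply: leM_or_r.
Qed.

Lemma prime_filterM_impE (U : set M) (a b : M) : prime_filterM U ->
  U (f_imp a b) <-> (U a -> U b).
Proof.
move=> pU; have [impor orimp] := ba_imp_def (bp_quotient_laws HB) a b.
have -> : U (f_imp a b) <-> U (f_or (f_neg a) b).
  by split=> Uab; [apply: (filterM_up pU Uab impor)|apply: (filterM_up pU Uab orimp)].
rewrite prime_filterM_orE // prime_filterM_negE //.
split=> [[//|//]|Uab]; have [Ua|] := pselect (U a); last by left.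
by right; apply: Uab.
Qed.

End PrimeFilters.

(** * The canonical frame *)

Section CanonicalFrame.
Context (V : eqType) (C : constants) (M : domain C) (HM : S4_model V M).

Let HB : boolean_prealgebra M := S3_prealgebra (S4_S3 HM) (S4_normal HM).
Let HF : nec_filter M := S3_filter (S4_S3 HM) (S4_normal HM).
Let HI : S3_inequalities V M := S3_ineq (S4_S3 HM) (S4_normal HM).
Let HT : truth_conditions V M := S3_truth (S4_S3 HM).

Lemma NEC_top : NEC (f_top M).
Proof. by have [a Na] := S4_normal HM; apply: (nec_up HF Na); apply: leM_top. Qed.

Lemma leM_TRUE (a b : M) : TRUE a -> leM a b -> TRUE b.
Proof. by move=> Ta /(nec_true HF)/(true_imp HT); apply. Qed.

(** Necessity of an element is truth of its box, and truth passes up along the inequality of S4. *)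
Lemma NEC_box (a : M) : NEC a -> NEC (f_box a).
Proof.
move=> Na; apply/(true_box HT); apply: leM_TRUE (S4_box HM a).
exact/(true_box HT).
Qed.

(** Both inequalities say that the box of an implication is true, and [box_S3] leads from the first
    box to the second. *)
Lemma leM_box (a b : M) : leM a b -> leM (f_box a) (f_box b).
Proof.
move=> ab; apply/(true_box HT); apply: leM_TRUE (box_S3 HI a b).
exact/(true_box HT).
Qed.

Lemma filterM_box (U : set M) : prime_filterM U -> filterM [set a | U (f_box a)].
Proof.
move=> pU; split=> /= [a b Ua ab|a b Ua Ub|].
- by apply: (filterM_up pU Ua); apply: leM_box.
- have : U (f_box (f_imp a (f_and a b))).
    by apply: (filterM_up pU Ub); apply: leM_box; apply: leM_imp_and.
  move=> /(filterM_up pU)/(_ (box_K HI _ _))/(prime_filterM_impE HB _ _ pU).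
  exact.
(* [f_box (f_top M)] is necessary, hence above top, hence in every filter. *)
- apply: (filterM_up pU (filterM_top pU)); apply: (nec_up HF (NEC_box NEC_top)).
  exact: leM_imp.
Qed.

Definition canonical_world : Type := {U : set M | prime_filterM U}.

Definition canonical_acc (U U' : canonical_world) : Prop :=
  forall a, sval U (f_box a) -> sval U' a.

Lemma canonical_acc_refl U : canonical_acc U U.
Proof. by move=> a Ua; apply: (filterM_up (svalP U) Ua); apply: (box_T HI). Qed.

Lemma canonical_acc_trans U U' U'' :
  canonical_acc U U' -> canonical_acc U' U'' -> canonical_acc U U''.
Proof.
move=> UU' U'U'' a Ua; apply/U'U''/UU'.
by apply: (filterM_up (svalP U) Ua); apply: (S4_box HM).
Qed.

Definition canonical_frame : S4_frame :=
  S4Frame canonical_acc_refl canonical_acc_trans.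

Lemma prime_filterM_TRUE : prime_filterM (@TRUE C M).
Proof.
split; [split|exact: (true_bot HT)|by move=> a b /(true_or HT)].
- exact: leM_TRUE.
- by move=> a b Ta Tb; apply/(true_and HT).
- exact: (true_top HT).
Qed.

Definition actual_world : canonical_frame := exist _ _ prime_filterM_TRUE.

Lemma canonical_boxP (U : canonical_frame) (a : M) :
  sval U (f_box a) <-> forall U' : canonical_frame, acc U U' -> sval U' a.
Proof.
split=> [Ua U' UU'|all_a]; first exact: UU'.
apply: contrapT => Ua.
have [U' [pU' sub U'a]] := prime_filterM_separation HB (filterM_box (svalP U)) Ua.
exact/U'a/(all_a (exist _ U' pU'))/sub.
Qed.

Context (gam : V -> M).

Definition canonical_valuation (x : V) : set canonical_frame :=
  [set U | sval U (gam x)].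

Lemma truth_lemma (A : mform V) (U : canonical_frame) :
  sval U (eval gam (emb C A)) <-> forces canonical_valuation U A.
Proof.
elim: A U => [x||| A IH|A IHA B IHB|A IHA B IHB|A IHA B IHB|A IH] U /=;
  have pU := svalP U.
- by [].
- by rewrite Gamma_bot; split=> // /(prime_filterM_bot pU).
- by rewrite Gamma_top; split=> // _; apply: (filterM_top pU).
- by rewrite (prime_filterM_negE HB) // IH.
- by rewrite (prime_filterM_impE HB) // IHA IHB.
- by rewrite (prime_filterM_orE HB) // IHA IHB.
- by rewrite (prime_filterM_andE HB) // IHA IHB.
- by rewrite canonical_boxP; split=> h U' /h /IH.
Qed.

(** At the actual world, membership of a box means necessity, so the boxed biconditional puts both
    implications in [NEC]. *)
Lemma forces_box_iff (A B : mform V) :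
  forces canonical_valuation actual_world (MBox (MIff A B)) <->
  eqvM (eval gam (emb C A)) (eval gam (emb C B)).
Proof.
rewrite -truth_lemma /= (true_box HT); split=> [Nab|[Nab Nba]].
  by split; apply: (nec_up HF Nab); [exact: leM_and_l|exact: leM_and_r].
exact: (nec_and HF).
Qed.

Lemma collapse_NEC (A : form V C) :
  collapse V M -> NEC (eval gam A) -> eval gam A = f_top M.
Proof.
(* Collapse is instantiated with the constant for top, whose denotation is always necessary. *)
move=> /(_ gam A (Const (ctop C))); rewrite /holds /= Gamma_top => col NA.
apply/(true_id HT); move/(true_imp HT): col; apply.
by apply/(true_and HT); split; apply/(true_box HT) => //; apply: NEC_top.
Qed.

End CanonicalFrame.

(** If [f_imp c d] is top, then meeting [c] with top, written as [f_or (f_neg c) d], gives [c] as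
    its meet with [d]; commutativity does the rest. *)
Lemma boolean_algebra_anti (C : constants) (M : domain C) (a b : M) :
  boolean_algebra M -> f_imp a b = f_top M -> f_imp b a = f_top M -> a = b.
Proof.
move=> laws ab ba.
have meetE (c d : M) : f_imp c d = f_top M -> c = f_and c d.
  move=> cd; rewrite -{1}(ba_and_top laws c) -cd (ba_imp_def laws).
  by rewrite (ba_and_distr laws) (ba_and_neg laws) (ba_or_comm laws) (ba_or_bot laws).
by rewrite (meetE a b ab) (ba_and_comm laws) -(meetE b a ba).
Qed.

Theorem theorem35 (V : eqType) (C : constants) (M : domain C) (gam : V -> M)
    (HM : S4_model V M) :
  exists (F : S4_frame) (g : V -> set F) (w : F),
    (forall A : mform V, holds gam (emb C A) <-> forces g w A) /\
    (forall A B : mform V,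
       holds gam (Id (emb C A) (emb C B)) -> forces g w (MBox (MIff A B))) /\
    (collapse V M -> boolean_algebra M ->
     forall A B : mform V,
       holds gam (Id (emb C A) (emb C B)) <-> forces g w (MBox (MIff A B))).
Proof.
have HT := S3_truth (S4_S3 HM).
exists (canonical_frame HM), (canonical_valuation gam), (actual_world HM).
have id_box (A B : mform V) : holds gam (Id (emb C A) (emb C B)) ->
    forces (canonical_valuation gam) (actual_world HM) (MBox (MIff A B)).
  move=> /(true_id HT) AB; apply/forces_box_iff; rewrite [eval _ _]AB.
  exact: (eqvM_refl (S3_prealgebra (S4_S3 HM) (S4_normal HM))).
split; first by move=> A; apply: (truth_lemma gam A (actual_world HM)).
split=> // col BA A B; split; first exact: id_box.
move=> /forces_box_iff[AB BA']; apply/(true_id HT).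
apply: boolean_algebra_anti => //.
  (* Collapse speaks of formulas, so each necessary implication is presented as the denotation of
     one. *)
  exact: (collapse_NEC HM (A := Imp (emb C A) (emb C B))).
exact: (collapse_NEC HM (A := Imp (emb C B) (emb C A))).
Qed.
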